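(* Let $G$ be a finite group and $X$ a compact $G$-ANR. Let $\tilde G=G\times G$ act on $X\times X$ by $(g_1,g_2)(x_1,x_2)=(g_1x_1,g_2x_2)$ and let $\daleth(X)=\tilde G\cdot\Delta(X)\subseteq X\times X$ be the saturation of the diagonal $\Delta(X)=\{(x,x): x\in X\}$. Then $\daleth(X)$ is a $\tilde G$-ANR.
   Context: For a compact Lie group $K$, a $K$-ANR is a metrizable $K$-space which is an equivariant neighbourhood retract of every metrizable $K$-space containing it as a closed $K$-invariant subspace. *)

(* Defs.v *)
From mathcomp Require Import all_boot all_order all_algebra all_fingroup.
From mathcomp Require Import all_classical all_reals all_analysis.

Set Implicit Arguments.
Unset Strict Implicit.
Unset Printing Implicit Defensive.

Import Order.TTheory GRing.Theory Num.Theory.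

Local Open Scope classical_set_scope.
Local Open Scope ring_scope.

Definition metrizable (R : realType) (T : topologicalType) : Prop :=
  exists d : T -> T -> R,
    [/\ forall x y, 0 <= d x y,
        forall x y, d x y = 0 <-> x = y,
        forall x y, d x y = d y x,
        forall x y z, d x z <= d x y + d y z &
        forall (x : T) (A : set T), nbhs x A <->
          exists2 e : R, 0 < e & [set y | d x y < e] `<=` A].

(* Left actions, as opposed to the right actions of [mathcomp.fingroup.action];
   a finite group is a compact Lie group for the discrete topology. *)
Record gspace (gT : finGroupType) := GSpace {
  gcarrier :> topologicalType;
  gact : gT -> gcarrier -> gcarrier;
  gact1 : forall x, gact 1%g x = x;
  gactM : forall g h x, gact (g * h)%g x = gact g (gact h x);
  gact_continuous :
    continuous (fun p : discrete_topology gT * gcarrier => gact p.1 p.2)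
}.

Definition ginvariant (gT : finGroupType) (X : gspace gT) (A : set X) : Prop :=
  forall g x, A x -> A (gact g x).

Definition saturation (gT : finGroupType) (X : gspace gT) (A : set X) : set X :=
  [set gact g x | g in [set: gT] & x in A].

Record closed_gembedding (gT : finGroupType) (X Z : gspace gT) (i : X -> Z) :
    Prop := ClosedGEmbedding {
  gembedding_equivariant : forall g x, i (gact g x) = gact g (i x);
  gembedding_injective : injective i;
  gembedding_initial : forall A : set X,
    open A <-> exists2 B : set Z, open B & i @^-1` B = A;
  gembedding_closed : closed (range i)
}.

(* The retraction [U -> A] is encoded as the restriction to [U] of a map
   [r : Z -> Z], since there is no map [Z -> A] when [A] is empty. *)
Definition equivariant_nbhs_retract (gT : finGroupType) (Z : gspace gT)
    (A : set Z) : Prop :=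
  exists (U : set Z) (r : Z -> Z),
    [/\ set_nbhs A U /\ ginvariant U,
        {within U, continuous r},
        r @` U `<=` A,
        forall a, A a -> r a = a &
        forall g z, U z -> r (gact g z) = gact g (r z)].

Definition GANR (R : realType) (gT : finGroupType) (X : gspace gT) : Prop :=
  metrizable R X /\
  forall (Z : gspace gT) (i : X -> Z),
    metrizable R Z -> closed_gembedding i ->
    equivariant_nbhs_retract (range i).

Lemma gact_continuous_each (gT : finGroupType) (X : gspace gT) (g : gT) :
  continuous (@gact gT X g).
Proof.
move=> x B nB.
have [[P Q] /= [Pg Qx] PQB] := @gact_continuous gT X (g, x) B nB.
apply: filterS Qx => y Qy.
by apply: (PQB (g, y)); split => //; exact: nbhs_singleton Pg.
Qed.

Lemma continuous_discrete_act (gT : finGroupType) (T : topologicalType)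
    (a : gT -> T -> T) :
  (forall g, continuous (a g)) ->
  continuous (fun p : discrete_topology gT * T => a p.1 p.2).
Proof.
move=> ca [g x] /= B /ca nB.
exists ([set g], [set y | B (a g y)]); first by split.
by case=> h y /= [-> ].
Qed.

Section prod_gspace.
Variables (gT1 gT2 : finGroupType) (X1 : gspace gT1) (X2 : gspace gT2).

Definition prod_gact (g : gT1 * gT2) (x : X1 * X2) : X1 * X2 :=
  (gact g.1 x.1, gact g.2 x.2).

Fact prod_gact1 x : prod_gact 1%g x = x.
Proof. by case: x => x1 x2; rewrite /prod_gact !gact1. Qed.

Fact prod_gactM g h x : prod_gact (g * h)%g x = prod_gact g (prod_gact h x).
Proof. by rewrite /prod_gact !gactM. Qed.

Fact prod_gact_continuous :
  continuous (fun p : discrete_topology (gT1 * gT2)%type * (X1 * X2)%type =>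
    prod_gact p.1 p.2).
Proof.
apply: continuous_discrete_act => g x.
apply: cvg_pair.
- apply: (@continuous_comp _ _ _ fst (gact g.1)); first exact: cvg_fst.
  exact: gact_continuous_each.
- apply: (@continuous_comp _ _ _ snd (gact g.2)); first exact: cvg_snd.
  exact: gact_continuous_each.
Qed.

Definition prod_gspace : gspace (gT1 * gT2)%type :=
  GSpace prod_gact1 prod_gactM prod_gact_continuous.

End prod_gspace.

Section sub_gspace.
Variables (gT : finGroupType) (X : gspace gT) (A : set X).
Hypothesis invA : ginvariant A.

Definition sub_gact (g : gT) (x : set_type A) : set_type A :=
  SigSub (mem_set (invA g (set_valP x))).

Fact sub_gact1 x : sub_gact 1%g x = x.
Proof. by apply: val_inj; rewrite /= gact1. Qed.

Fact sub_gactM g h x : sub_gact (g * h)%g x = sub_gact g (sub_gact h x).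
Proof. by apply: val_inj; rewrite /= gactM. Qed.

Fact sub_gact_continuous :
  continuous (fun p : discrete_topology gT * set_type A => sub_gact p.1 p.2).
Proof.
apply: continuous_discrete_act => g.
apply: continuous_comp_initial => x.
apply: (@continuous_comp _ _ _ (set_val : set_type A -> X) (gact g)).
  exact: initial_continuous.
exact: gact_continuous_each.
Qed.

Definition sub_gspace : gspace gT :=
  GSpace sub_gact1 sub_gactM sub_gact_continuous.

End sub_gspace.

Lemma saturation_ginvariant (gT : finGroupType) (X : gspace gT) (A : set X) :
  ginvariant (saturation A).
Proof.
move=> g _ [h _ [x Ax <-]]; exists (g * h)%g => //.
by exists x => //; rewrite gactM.
Qed.

Definition daleth (gT : finGroupType) (X : gspace gT) :
    gspace (gT * gT)%type :=
  sub_gspace (@saturation_ginvariant _ (prod_gspace X X) diagonal).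

(* Main.v *)
(* Embed X equivariantly in the G-space E of real functions on X by the
   Kuratowski map x |-> d(x, _), for an invariant metric d; a G-neighbourhood V
   of X in E retracts onto X. The space daleth(X) is the union of the graphs of
   the maps x |-> g x. Let Z be a metrizable (G x G)-space containing it as a
   closed subspace. The two coordinates extend, by Tietze's theorem on Z * X and
   averaging, to equivariant maps phi, psi : Z -> E, and it remains to push
   (phi, psi) into the union of the graphs psi = g phi in E * E. Let m be the
   least of the distances delta_g between psi and g phi. A subset S of G has
   positive weight only if it contains all g with delta_g = m and only g with
   delta_g < 2 m; replace phi by the weighted mean, over h in the subgroups
   generated by S^-1 S, of its translates by h, and psi by g times this mean
   for a g with delta_g = m. The mean is fixed by a^-1 b when
   delta_a = delta_b = m, so the choice of g is irrelevant; and near a point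
   with m = 0 all the h involved nearly fix phi, so the construction is
   continuous there too. *)
Require Import Defs.
From mathcomp Require Import all_boot all_order all_algebra all_fingroup.
From mathcomp Require Import all_classical all_reals all_analysis.
From mathcomp Require Import lra.

(* [Import Defs] again, because mathcomp's [gact] shadows the one of Defs. *)
Import Defs Order.TTheory GRing.Theory Num.Theory.
Import numFieldNormedType.Exports.

Local Open Scope classical_set_scope.
Local Open Scope ring_scope.

(** * Metrics compatible with a topology, and invariant metrics *)

Definition metrizes (R : realType) (T : topologicalType) (d : T -> T -> R) :=
  [/\ forall x y, 0 <= d x y,
      forall x y, d x y = 0 <-> x = y,
      forall x y, d x y = d y x,
      forall x y z, d x z <= d x y + d y z &
      forall (x : T) (A : set T), nbhs x A <->
        exists2 e : R, 0 < e & [set y | d x y < e] `<=` A].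

Section metrizes.
Context {R : realType} {T : topologicalType} {d : T -> T -> R}.
Hypothesis md : metrizes R T d.

Lemma metrizes_near x e : 0 < e -> \forall y \near x, d x y < e.
Proof. by case: md => _ _ _ _ dn e0; apply/dn; exists e. Qed.

Lemma metrizes_refl x : d x x = 0.
Proof. by case: md => _ d0 _ _ _; apply/d0. Qed.

Lemma metrizes_continuous : continuous (fun p : T * T => d p.1 p.2).
Proof.
case: md => _ _ ds dt _ [x y]; apply/cvgrPdist_lt => /= e e0.
have e20 : 0 < e / 2 by rewrite divr_gt0.
exists ([set z | d x z < e / 2], [set z | d y z < e / 2]).
  by split; exact: metrizes_near.
move=> [x' y'] [/= xx' yy'].
have := dt x x' y; have := dt x' y' y; have := dt x' x y'; have := dt x y y'.
by rewrite (ds x' x) (ds y' y) ltr_norml; lra.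
Qed.

Lemma metrizes_continuous2 (Z : topologicalType) (f g : Z -> T) :
  continuous f -> continuous g -> continuous (fun z => d (f z) (g z)).
Proof.
move=> cf cg z; apply: (@continuous_comp _ _ _
  (fun z => (f z, g z)) (fun p => d p.1 p.2)).
  by apply: cvg_pair; [exact: cf|exact: cg].
exact: metrizes_continuous.
Qed.

Lemma metrizes_hausdorff : hausdorff_space T.
Proof.
case: md => d0 dE ds dt _ x y xy; apply/dE/eqP; rewrite eq_le d0 andbT.
apply/ler_addgt0Pr => e e0; rewrite add0r.
have e20 : 0 < e / 2 by rewrite divr_gt0.
have [z [/= xz yz]] := xy _ _ (metrizes_near x _ e20) (metrizes_near y _ e20).
by have := dt x z y; rewrite (ds z y); lra.
Qed.

(** Around each point of [A] take the ball whose radius is half a lower bound for the distance to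
    [B], and likewise with [A] and [B] exchanged. By the triangle inequality no two such balls
    meet. *)
Lemma metrizes_normal : normal_space T.
Proof.
case: md => d0 dE ds dt dn; apply/(@normal_openP R) => A B cA cB AB.
(* A radius is attached to every [x] so that choice applies; for [x] in [C] the value [1] is
   arbitrary. *)
have far (C : set T) : closed C -> forall x, exists e, 0 < e /\
    (~ C x -> forall y, C y -> e <= d x y).
  move=> cC x; have [Cx|nCx] := pselect (C x); first by exists 1.
  have /dn[e e0 eC] : nbhs x (~` C).
    by apply: open_nbhs_nbhs; split => //; exact: closed_openC.
  exists e; split=> // _ y Cy; rewrite leNgt; apply/negP => /eC; exact.
have /choice[eA eAP] := far B cB; have /choice[eB eBP] := far A cA.
have nB a : A a -> ~ B a.
  by move=> Aa Ba; have : (A `&` B) a by []; rewrite AB.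
have nA b : B b -> ~ A b by move=> Bb /nB.
exists (\bigcup_(a in A) [set y | d a y < eA a / 2]°).
exists (\bigcup_(b in B) [set y | d b y < eB b / 2]°); split.
- by apply: bigcup_open => ? _; exact: open_interior.
- by apply: bigcup_open => ? _; exact: open_interior.
- move=> a Aa; exists a => //; apply: metrizes_near.
  by rewrite divr_gt0// (eAP a).1.
- move=> b Bb; exists b => //; apply: metrizes_near.
  by rewrite divr_gt0// (eBP b).1.
- apply/nonemptyPn => -[z [[a Aa /interior_subset az]]].
  move=> [b Bb /interior_subset bz].
  have := (eAP a).2 (nB _ Aa) b Bb; have := (eBP b).2 (nA _ Bb) a Aa.
  rewrite /= in az bz; have := dt a z b.
  by rewrite (ds b a) (ds z b); lra.
Qed.

Lemma metrizable_set_type (A : set T) : metrizable R (set_type A).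
Proof.
case: md => d0 dE ds dt dn; exists (fun x y => d (\val x) (\val y)); split.
- by move=> x y; exact: d0.
- move=> x y; split => [/dE/val_inj //|->]; exact: metrizes_refl.
- by move=> x y; exact: ds.
- by move=> x y z; exact: dt.
- move=> x B; split.
  + move=> [_ [[C oC <-] /= Cx] CB].
    have /dn[e e0 eC] : nbhs (\val x) C by exact: open_nbhs_nbhs.
    by exists e => // y /eC Cy; exact: CB.
  + move=> [e e0 eB]; apply: filterS eB _.
    have cv : {for x, continuous (set_val : set_type A -> T)}.
      exact: initial_continuous.
    exact: cv (metrizes_near _ _ e0).
Qed.

End metrizes.

Lemma metrizable_prod (R : realType) (S T : topologicalType) :
  metrizable R S -> metrizable R T -> metrizable R (S * T)%type.
Proof.
move=> [d1 [p1 e1 s1 t1 n1]] [d2 [p2 e2 s2 t2 n2]].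
exists (fun x y => d1 x.1 y.1 + d2 x.2 y.2); split.
- by move=> x y; rewrite addr_ge0.
- move=> [x x'] [y y'] /=; split.
    move/eqP; rewrite paddr_eq0// => /andP[/eqP/e1 -> /eqP/e2 ->] //.
  by move=> [-> ->]; rewrite (e1 _ _).2// (e2 _ _).2// addr0.
- by move=> x y; rewrite s1 s2.
- by move=> x y z; rewrite addrACA lerD.
- move=> [x y] A; split => [[[P Q] /= [nP nQ] PQ]|[e e0 eA]].
    have [[a a0 aP] [b b0 bQ]] := ((n1 _ _).1 nP, (n2 _ _).1 nQ).
    exists (Num.min a b); first by rewrite lt_min a0.
    move=> [x' y'] /=; rewrite lt_min => /andP[xa yb]; apply: PQ; split => /=.
    + by apply: aP => /=; apply: le_lt_trans xa; rewrite lerDl.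
    + by apply: bQ => /=; apply: le_lt_trans yb; rewrite lerDr.
  exists ([set z | d1 x z < e / 2], [set z | d2 y z < e / 2]).
    by split; [apply/n1|apply/n2]; exists (e / 2) => //; rewrite divr_gt0.
  by move=> [x' y'] [/= xx' yy']; apply: eA => /=; lra.
Qed.

(** Summing a metric over the group makes it invariant. The term of [1] bounds the sum from below,
    and continuity of the finitely many translations makes it small near [x], so the topology is the
    same. *)
Lemma metrizable_invariant (R : realType) (gT : finGroupType) (X : gspace gT) :
  metrizable R X -> exists2 d, metrizes R X d &
    forall g x y, d (gact g x) (gact g y) = d x y.
Proof.
move=> [d md]; have [d0 dE ds dt dn] := md.
exists (fun x y => \sum_(g : gT) d (gact g x) (gact g y)); last first.
  move=> g x y; rewrite [RHS](reindex_inj (mulIg g)) /=.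
  by apply: eq_bigr => h _; rewrite !gactM.
have d_le x y : d x y <= \sum_g d (gact g x) (gact g y).
  by rewrite (bigD1 1%g)//= !gact1 lerDl sumr_ge0.
split.
- by move=> x y; rewrite sumr_ge0.
- move=> x y; split => [xy|<-]; last first.
    by apply: big1 => g _; exact: (metrizes_refl md).
  by apply/dE/eqP; rewrite eq_le d0 andbT -xy.
- by move=> x y; apply: eq_bigr => g _; rewrite ds.
- by move=> x y z; rewrite -big_split; apply: ler_sum => g _; exact: dt.
- move=> x A; split => [/dn[e e0 eA]|[e e0 eA]].
    by exists e => // y /= xy; apply: eA; exact: le_lt_trans xy.
  have n0 : 0 < #|gT|%:R :> R by rewrite ltr0n; apply/card_gt0P; exists 1%g.
  have : \forall y \near x, forall g, d (gact g x) (gact g y) < e / #|gT|%:R.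
    apply: filter_forall => g.
    apply: (@gact_continuous_each gT X g x _ (metrizes_near md _ _ _)).
    by rewrite divr_gt0.
  apply: filterS => y xy; apply: eA => /=.
  rewrite (@lt_le_trans _ _ (\sum_(g : gT) e / #|gT|%:R))//.
    by apply: ltr_sum; [apply/hasP; exists 1%g; rewrite ?mem_index_enum|].
  by rewrite sumr_const -(mulr_natr (e / _)) divfK// gt_eqF.
Qed.

(** * The space of real functions under uniform convergence *)

Lemma nbhs_uniformP (R : realType) (T : choiceType)
    (f : arrow_uniform_type T R) (A : set (arrow_uniform_type T R)) :
  nbhs f A <-> exists2 e : R, 0 < e &
    [set g | forall x, `|f x - g x| < e] `<=` A.
Proof. by rewrite -nbhs_ballE; split=> -[e e0 eA]; exists e. Qed.

Lemma metrizable_uniform (R : realType) (T : choiceType) :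
  metrizable R (arrow_uniform_type T R).
Proof.
(* The functions may be unbounded, so differences are cut off at [1] for the supremum to exist. *)
pose u (f g : T -> R) x := Num.min 1 `|f x - g x|.
pose d (f g : T -> R) := sup (range (u f g)).
have u0 f g x : 0 <= u f g x by rewrite le_min ler01 normr_ge0.
have us f g : has_ubound (range (u f g)).
  by exists 1 => _ [x _ <-]; rewrite ge_min lexx.
have u_le f g x : u f g x <= d f g by apply: ub_le_sup => //; exists x.
have d0 f g : 0 <= d f g.
  (* If [T] is empty, the supremum takes its default value [0]. *)
  have [r0|/set0P[_ [x _ _]]] := eqVneq (range (u f g)) set0.
    by rewrite /d r0 sup0.
  exact: le_trans (u_le _ _ x).
have d_le f g e : 0 <= e -> (forall x, u f g x <= e) -> d f g <= e.
  move=> e0 ue; rewrite /d.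
  have [->|ne] := eqVneq (range (u f g)) set0; first by rewrite sup0.
  by apply: ge_sup; [exact/set0P|move=> _ [x _ <-]].
exists d; split.
- by [].
- move=> f g; split => [fg|->].
    apply/funext => x; apply/eqP; rewrite -subr_eq0 -normr_le0.
    by have := u_le f g x; rewrite fg /u ge_min leNgt ltr01.
  apply/eqP; rewrite eq_le d0 andbT; apply: d_le => // x.
  by rewrite /u subrr normr0 ge_min lexx orbT.
- move=> f g; rewrite /d (_ : u f g = u g f)//.
  by apply/funext => x; rewrite /u distrC.
- move=> f g h; apply: d_le; first by rewrite addr_ge0.
  move=> x; apply: (le_trans _ (lerD (u_le f g x) (u_le g h x))).
  have := ler_distD (g x) (f x) (h x); rewrite /u /Num.min.
  by have := normr_ge0 (f x - g x); have := normr_ge0 (g x - h x);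
    do 3!case: ifP => ?; lra.
- move=> f A; rewrite nbhs_uniformP; split => -[e e0 eA].
    exists (Num.min 1 e); first by rewrite lt_min ltr01.
    move=> g /= fg; apply: eA => x /=; have := le_lt_trans (u_le f g x) fg.
    by rewrite /u lt_min !gt_min ltxx/= => /andP[a1 /orP[]]; lra.
  exists (e / 2); first by rewrite divr_gt0.
  move=> g /= fg; apply: eA => /=; apply: (@le_lt_trans _ _ (e / 2)); last lra.
  apply: d_le => [|x]; first by rewrite divr_ge0// ltW.
  by rewrite /u ge_min (ltW (fg x)) orbT.
Qed.

(** Joint continuity gives the estimate locally in [x]; compactness makes one neighbourhood of [z]
    serve all [x]. *)
Lemma continuous_curry_uniform (R : realType) (Z X : topologicalType)
    (f : Z -> X -> R) : compact [set: X] ->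
  continuous (fun p => f p.1 p.2) ->
  continuous (f : Z -> arrow_uniform_type X R).
Proof.
move=> /compact_near_coveringP cX cf z A /nbhs_uniformP[e e0 eA].
apply: (filterS (P := fun z' => forall x, setT x -> `|f z x - f z' x| < e)).
  by move=> z' zz'; apply: eA => x; exact: zz'.
apply: cX => x _; have e20 : 0 < e / 2 by rewrite divr_gt0.
have /cvgrPdist_lt /(_ _ e20)[[P Q] /= [Pz Qx] PQ] := cf (z, x).
exists (Q, P); first by split.
move=> [x' z'] [/= Qx' Pz'].
have := PQ (z, x') (conj (nbhs_singleton Pz) Qx').
have := PQ (z', x') (conj Pz' Qx').
rewrite /= => h1 h2; have := ler_distD (f z x) (f z x') (f z' x').
by rewrite (distrC (f z x') (f z x)); lra.
Qed.

Section fun_gspace.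
Context (R : realType) {gT : finGroupType} (X : gspace gT).

Definition fun_gact (g : gT) (f : arrow_uniform_type X R) :
  arrow_uniform_type X R := fun x => f (gact g^-1%g x).

Fact fun_gact1 f : fun_gact 1%g f = f.
Proof. by apply/funext => x; rewrite /fun_gact invg1 gact1. Qed.

Fact fun_gactM g h f : fun_gact (g * h)%g f = fun_gact g (fun_gact h f).
Proof. by apply/funext => x; rewrite /fun_gact invMg gactM. Qed.

Fact fun_gact_continuous : continuous
  (fun p : discrete_topology gT * arrow_uniform_type X R => fun_gact p.1 p.2).
Proof.
apply: continuous_discrete_act => g f A /nbhs_uniformP[e e0 eA].
by apply/nbhs_uniformP; exists e => // h fh; apply: eA => x; exact: fh.
Qed.

Definition fun_gspace : gspace gT :=
  GSpace fun_gact1 fun_gactM fun_gact_continuous.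

End fun_gspace.

(** A continuous map from a compact to a Hausdorff space is closed, so an injective one induces the
    topology of its source. *)
Lemma closed_gembedding_compact (gT : finGroupType) (X Z : gspace gT)
    (i : X -> Z) : compact [set: X] -> hausdorff_space Z ->
  continuous i -> injective i -> (forall g x, i (gact g x) = gact g (i x)) ->
  closed_gembedding i.
Proof.
move=> cX hZ ci injI iE.
have closed_image A : closed A -> closed (i @` A).
  move=> cA; apply: compact_closed => //; apply: continuous_compact.
    exact: continuous_subspaceT.
  exact: subclosed_compact cX _.
split=> // [A|].
  split => [oA|[B oB <-]]; last by apply: open_comp => // x _; exact: ci.
  exists (~` (i @` ~` A)).
    by apply: closed_openC; apply: closed_image; exact: open_closedC.
  rewrite predeqE => x; split => /= [nAx|Ax [y nAy /injI yx]].
    by apply: contrapT => Ax; apply: nAx; exists x.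
  by apply: nAy; rewrite yx.
exact: (closed_image setT closedT).
Qed.

(** * Averaged Tietze extension and weighted means *)

Lemma continuous_sumr (R : realType) (T : topologicalType) (I : Type)
    (r : seq I) (P : pred I) (f : I -> T -> R) :
  (forall i, P i -> continuous (f i)) ->
  continuous (fun t => \sum_(i <- r | P i) f i t).
Proof.
by apply: continuous_big => p; apply: cvgD; [exact: cvg_fst|exact: cvg_snd].
Qed.

Lemma continuous_prodr (R : realType) (T : topologicalType) (I : Type)
    (r : seq I) (P : pred I) (f : I -> T -> R) :
  (forall i, P i -> continuous (f i)) ->
  continuous (fun t => \prod_(i <- r | P i) f i t).
Proof.
by apply: continuous_big => p; apply: cvgM; [exact: cvg_fst|exact: cvg_snd].
Qed.

(** A Tietze extension is averaged over the group; on [A] every term of the average is [f w], so the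
    average still extends [f]. *)
Lemma equivariant_tietze (R : realType) (gT : finGroupType)
    (W : topologicalType) (a : gT -> W -> W) (A : set W) (f : W -> R) (M : R) :
  normal_space W -> closed A ->
  (forall g, continuous (a g)) ->
  (forall g h w, a (g * h)%g w = a g (a h w)) ->
  (forall g w, A w -> A (a g w)) ->
  {within A, continuous f} ->
  (forall w, A w -> `|f w| <= M) ->
  (forall g w, A w -> f (a g w) = f w) ->
  exists F : W -> R, [/\ continuous F, forall w, A w -> F w = f w &
    forall g w, F (a g w) = F w].
Proof.
move=> nW cA ca aM Aa cf fM fa.
(* The extension theorem needs a positive bound, while [M] may be [0], or negative if [A] is
   empty. *)
have M0 : 0 < `|M| + 1 by rewrite ltr_pwDr.
have [|F [fF cF _]] := continuous_bounded_extension nW cA M0 cf.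
  by move=> w /fM /le_trans; apply; rewrite (le_trans (ler_norm _))// lerDl.
exists (fun w => (\sum_(g : gT) F (a g w)) / #|gT|%:R); split.
- move=> w; apply: cvgM; last exact: cvg_cst.
  apply: continuous_sumr => g _ {}w.
  by apply: (@continuous_comp _ _ _ (a g) F); [exact: ca|exact: cF].
- move=> w Aw; rewrite (eq_bigr (fun=> f w)) => [|g _].
    rewrite sumr_const -(mulr_natr (f w)) mulfK// pnatr_eq0 -lt0n.
    by apply/card_gt0P; exists 1%g.
  by rewrite -fF ?inE; [exact: fa|exact: Aa].
- move=> g w; congr (_ / _); rewrite [RHS](reindex_inj (mulIg g)) /=.
  by apply: eq_bigr => h _; rewrite aM.
Qed.

Definition mean {R : realType} {I : finType} (w f : I -> R) : R :=
  (\sum_i w i * f i) / \sum_i w i.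

(** The difference [a - mean w f] is the weighted mean of the [a - f i], to which indices of weight
    [0] contribute nothing. *)
Lemma mean_dist (R : realType) (I : finType) (w f : I -> R) (a e : R) :
  (forall i, 0 <= w i) -> 0 < \sum_i w i ->
  (forall i, w i != 0 -> `|a - f i| <= e) ->
  `|a - mean w f| <= e.
Proof.
move=> w0 W0 fe; rewrite /mean.
have -> : a - (\sum_i w i * f i) / \sum_i w i =
    (\sum_i w i * (a - f i)) / \sum_i w i.
  under [X in _ = X / _]eq_bigr do rewrite mulrBr.
  by rewrite sumrB -mulr_suml mulrBl mulrAC divff ?mul1r// gt_eqF.
rewrite normrM normfV (gtr0_norm W0) ler_pdivrMr// mulr_sumr.
apply: le_trans (ler_norm_sum _ _ _) _; apply: ler_sum => i _.
rewrite normrM ger0_norm// mulrC.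
by have [->|/fe fie] := eqVneq (w i) 0; [rewrite !mulr0|exact: ler_wpM2r].
Qed.

Lemma near_fst (S T : topologicalType) (s : S) (t : T) (P : S -> Prop) :
  (\forall u \near s, P u) -> \forall p \near (s, t), P p.1.
Proof. by move=> Ps; exact: (@cvg_fst _ _ (nbhs s) (nbhs t) _ P Ps). Qed.

(** * Pushing a pair of maps into the union of the graphs *)

Section graph_retraction.
Context {R : realType} {gT : finGroupType} {X : gspace gT}.
Context {Z : gspace (gT * gT)%type}.
Variables (phi psi : Z -> X -> R) (delta : gT -> Z -> R).
Hypothesis phi_continuous : continuous (fun p => phi p.1 p.2).
Hypothesis phi_equivariant :
  forall k z x, phi (gact k z) (gact k.1 x) = phi z x.
Hypothesis delta_continuous : forall g, continuous (delta g).
Hypothesis delta_ge0 : forall g z, 0 <= delta g z.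
Hypothesis delta_eq0 : forall g z,
  delta g z = 0 <-> forall x, psi z x = phi z (gact g^-1%g x).
Hypothesis delta_equivariant : forall k g z,
  delta (k.2 * g * k.1^-1)%g (gact k z) = delta g z.

(** An arbitrary choice among the minimizers, which need not vary continuously or equivariantly with
    [z]. *)
Definition nearest z := [arg min_(g < 1%g : gT) delta g z]%O.
Definition delta_min z := delta (nearest z) z.

Lemma delta_min_le g z : delta_min z <= delta g z.
Proof.
by rewrite /delta_min /nearest; case: arg_minP => // h _ /(_ g); apply.
Qed.

Lemma delta_min_eq0 g z : delta g z = 0 -> delta_min z = 0.
Proof.
by move=> g0; apply/eqP; rewrite eq_le delta_ge0 andbT -g0 delta_min_le.
Qed.

(** A minimizer at one point bounds the minimum at the other, so the minima differ by no more than
    some [delta g] does. *)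
Lemma delta_min_continuous : continuous delta_min.
Proof.
move=> z; apply/cvgrPdist_lt => /= e e0.
have : \forall y \near z, forall g, `|delta g z - delta g y| < e.
  apply: filter_forall => g.
  by have /cvgrPdist_lt := @delta_continuous g z; apply.
apply: filterS => y dy.
have := delta_min_le (nearest y) z; have := dy (nearest y).
have := delta_min_le (nearest z) y; have := dy (nearest z).
by rewrite -!/(delta_min _) !ltr_norml; rewrite /delta_min; lra.
Qed.

Lemma delta_min_equivariant k z : delta_min (gact k z) = delta_min z.
Proof.
apply/eqP; rewrite eq_le; apply/andP; split.
  by rewrite -[leRHS](delta_equivariant k) delta_min_le.
have := delta_equivariant k (k.2^-1 * nearest (gact k z) * k.1)%g z.
rewrite !mulgA mulgV mul1g mulgK => nkz.
by rewrite /delta_min nkz delta_min_le.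
Qed.

(** The product tends to [0] as an element of [S] reaches twice the minimum or one outside [S]
    reaches the minimum. Any constant above [1] would do in place of [2]. *)
Definition subset_weight (S : {set gT}) z : R :=
  \prod_g (if g \in S then Num.max 0 (2 * delta_min z - delta g z)
           else Num.max 0 (delta g z - delta_min z)).

(** The result of exchanging two sums: every [S] puts its weight on each element of the subgroup
    generated by [S^-1 * S]. *)
Definition weight (h : gT) z : R :=
  \sum_(S : {set gT} | h \in <<S^-1 * S>>%g) subset_weight S z.

Lemma subset_weight_ge0 S z : 0 <= subset_weight S z.
Proof. by apply: prodr_ge0 => g _; case: ifP => _; rewrite le_max lexx. Qed.

Lemma weight_ge0 h z : 0 <= weight h z.
Proof. by apply: sumr_ge0 => S _; exact: subset_weight_ge0. Qed.

Lemma subset_weight_neq0 S z : subset_weight S z != 0 ->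
  (forall g, g \in S -> delta g z < 2 * delta_min z) /\
  (forall g, delta g z = delta_min z -> g \in S).
Proof.
move=> /prodf_neq0 cS; split => g; last first.
  move=> dg; apply: contraTT (cS g isT) => /negPf ->.
  by rewrite dg subrr maxxx eqxx.
move=> gS; have := cS g isT; rewrite gS -subr_gt0.
by rewrite /Num.max; case: ifP; rewrite ?eqxx.
Qed.

(** The set of all [g] strictly below twice the minimum has positive weight, and [1] lies in its
    subgroup. Positivity of the minimum gives the gap for the [g] outside the set. *)
Lemma weight_sum_gt0 z : 0 < delta_min z -> 0 < \sum_h weight h z.
Proof.
move=> m0; pose S := [set g | delta g z < 2 * delta_min z]%SET.
have : 0 < subset_weight S z.
  apply: prodr_gt0 => g _; rewrite inE.
  have [gm|gm] := ltP (delta g z) (2 * delta_min z).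
    by rewrite lt_max subr_gt0 gm orbT.
  by rewrite lt_max subr_gt0 (lt_le_trans _ gm) ?orbT// ltr_pMl// ltr1n.
move=> /lt_le_trans; apply.
rewrite (bigD1 1%g)//= /weight (bigD1 S) ?group1//= -addrA lerDl addr_ge0//.
  by apply: sumr_ge0 => ? _; exact: subset_weight_ge0.
by apply: sumr_ge0 => ? _; exact: weight_ge0.
Qed.

Lemma weight_continuous h : continuous (weight h).
Proof.
apply: continuous_sumr => S _; apply: continuous_prodr => g _ z.
have cm := @delta_min_continuous z; have cd := @delta_continuous g z.
have cmax (f : Z -> R) : {for z, continuous f} ->
    {for z, continuous (fun y => Num.max 0 (f y))}.
  by move=> cf; apply: (@continuous_max _ _ (fun=> 0) f) => //; exact: cvg_cst.
case: (g \in S); apply: cmax.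
  by apply: cvgB => //; apply: cvgM => //; exact: cvg_cst.
exact: cvgB.
Qed.

(** Every [S] of nonzero weight contains both minimizers, so [a^-1 * b] lies in its subgroup. *)
Lemma weight_mulr h a b z :
  delta a z = delta_min z -> delta b z = delta_min z ->
  weight (h * (a^-1 * b))%g z = weight h z.
Proof.
move=> az bz; rewrite /weight big_mkcond [RHS]big_mkcond; apply: eq_bigr => S _.
have [->|/subset_weight_neq0[_ Sm]] := eqVneq (subset_weight S z) 0.
  by do 2!case: ifP.
rewrite groupMr//; apply: mem_gen; apply: mem_mulg; last exact: Sm.
by rewrite mem_invg invgK; exact: Sm.
Qed.

(** The action of [(b, a)] on subsets of the group that matches [delta_equivariant]. *)
Definition translate (a b : gT) (S : {set gT}) : {set gT} :=
  (a *: S :* b^-1)%g.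

Lemma mem_translate a b S g :
  ((a * g * b^-1)%g \in translate a b S) = (g \in S).
Proof. by rewrite mem_rcoset mem_lcoset invgK !mulgA mulgKV mulVg mul1g. Qed.

Lemma translateK a b : cancel (translate a b) (translate a^-1%g b^-1%g).
Proof.
move=> S; apply/setP => g; rewrite !(mem_rcoset, mem_lcoset) !invgK.
by rewrite !mulgA mulVg mul1g mulgKV.
Qed.

(** The factor [a] cancels in the product, which leaves a conjugation by [b^-1]; hence the
    conjugated index in [weight_equivariant]. *)
Lemma translate_gen a b S :
  (<<(translate a b S)^-1 * translate a b S>> = <<S^-1 * S>> :^ b^-1)%g.
Proof.
rewrite -genJ; congr (<<_>>)%g; rewrite /translate conjsgE invgK.
rewrite !invMg !invg_set1 invgK -!mulgA; congr (_ * (_ * _))%g.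
by rewrite !mulgA mulg_set1 mulVg mul1g.
Qed.

Lemma subset_weight_translate k S z :
  subset_weight (translate k.2 k.1 S) (gact k z) = subset_weight S z.
Proof.
rewrite /subset_weight (reindex (fun g => k.2 * g * k.1^-1)%g) /=.
  by apply: eq_bigr => g _; rewrite mem_translate delta_equivariant
    delta_min_equivariant.
apply: onW_bij; exists (fun g => k.2^-1 * g * k.1)%g => g.
  by rewrite !mulgA mulVg mul1g mulgKV.
by rewrite !mulgA mulgV mul1g mulgK.
Qed.

Lemma weight_equivariant k h z :
  weight (h ^ k.1^-1)%g (gact k z) = weight h z.
Proof.
rewrite /weight (reindex_inj (can_inj (translateK k.2 k.1))) /=.
apply: eq_big => [S|S _]; last exact: subset_weight_translate.
by rewrite translate_gen memJ_conjg.
Qed.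

(** Where [delta_min] is [0] all weights vanish and the mean would be the default [0]. The function
    [phi z (gact h x)] of [x] is the translate by [h^-1]; this is harmless, as subgroups are closed
    under inverses. *)
Definition phi_retract z x : R :=
  if delta_min z == 0 then phi z x
  else mean (weight^~ z) (fun h => phi z (gact h x)).

Definition psi_retract z x : R := phi_retract z (gact (nearest z)^-1%g x).

Lemma phi_retract_eq0 z : delta_min z = 0 -> phi_retract z = phi z.
Proof. by move=> z0; apply/funext => x; rewrite /phi_retract z0 eqxx. Qed.

(** Right multiplication by [a^-1 * b] preserves the weights and reindexes one mean into the other;
    if the minimum is [0], both sides are [psi z x]. This frees [psi_retract] from the choice made
    in [nearest]. *)
Lemma phi_retract_nearest a b z x :
  delta a z = delta_min z -> delta b z = delta_min z ->
  phi_retract z (gact a^-1%g x) = phi_retract z (gact b^-1%g x).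
Proof.
move=> az bz; rewrite /phi_retract; case: eqP => z0.
  have ha := (delta_eq0 a z).1 (etrans az z0).
  by rewrite -ha (delta_eq0 b z).1 // bz.
congr (_ / _); rewrite [RHS](reindex_inj (mulIg (a^-1 * b)%g)) /=.
apply: eq_bigr => h _; rewrite weight_mulr//; congr (_ * phi z _).
by rewrite -!gactM !mulgA mulgK.
Qed.

Lemma psi_retract_eq0 z : delta_min z = 0 -> psi_retract z = psi z.
Proof.
move=> z0; apply/funext => x; rewrite /psi_retract phi_retract_eq0//.
by rewrite ((delta_eq0 (nearest z) z).1 z0).
Qed.

Lemma phi_retract_equivariant k z x :
  phi_retract (gact k z) (gact k.1 x) = phi_retract z x.
Proof.
rewrite /phi_retract delta_min_equivariant phi_equivariant; case: eqP => // _.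
rewrite /mean; congr (_ / _); rewrite (reindex_inj (conjg_inj k.1^-1%g)) /=;
  apply: eq_bigr => h _; rewrite weight_equivariant//.
rewrite -gactM conjgE invgK !mulgA mulgKV gactM.
by rewrite phi_equivariant.
Qed.

(** Although [nearest] need not be equivariant, [k.2 * nearest z * k.1^-1] is a minimizer at the
    translated point and may replace the chosen one. *)
Lemma psi_retract_equivariant k z x :
  psi_retract (gact k z) (gact k.2 x) = psi_retract z x.
Proof.
rewrite /psi_retract (@phi_retract_nearest _ (k.2 * nearest z * k.1^-1)%g)//.
  by rewrite -gactM !invMg invgK !mulgA mulgKV gactM phi_retract_equivariant.
by rewrite delta_equivariant delta_min_equivariant.
Qed.

Lemma phi_gact_continuous h :
  continuous (fun p : Z * X => phi p.1 (gact h p.2)).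
Proof.
move=> [z x]; apply: (@continuous_comp _ _ _
  (fun p : Z * X => (p.1, gact h p.2)) (fun p => phi p.1 p.2)).
  apply: cvg_pair; first exact: cvg_fst.
  apply: (@continuous_comp _ _ _ snd (gact h)); first exact: cvg_snd.
  exact: gact_continuous_each.
exact: phi_continuous.
Qed.

(** Where [delta_min] is positive, this is locally a quotient of continuous functions. Where it is
    [0], all nearby means use only elements of the stabilizer of [phi z], so they stay close to
    [phi z x]. *)
Lemma phi_retract_continuous : continuous (fun p => phi_retract p.1 p.2).
Proof.
move=> [z x]; have [m0|m0] := eqVneq (delta_min z) 0; last first.
  have m_gt0 : 0 < delta_min z by rewrite lt_neqAle eq_sym m0 delta_ge0.
  have nm : \forall p \near (z, x), delta_min p.1 != 0.
    apply: (near_fst Z X _ _ (fun y => delta_min y != 0)).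
    apply: (@delta_min_continuous z (fun r => r != 0)).
    by apply: open_nbhs_nbhs; split => //; exact: open_neq.
  have cw h : continuous (fun p : Z * X => weight h p.1).
    move=> p; apply: (@continuous_comp _ _ _ fst (weight h)).
      exact: cvg_fst.
    exact: weight_continuous.
  have cmean : {for (z, x), continuous (fun p : Z * X =>
      (\sum_h weight h p.1 * phi p.1 (gact h p.2)) / \sum_h weight h p.1)}.
    apply: cvgM.
      apply: (@continuous_sumr _ _ _ _ _
        (fun h (p : Z * X) => weight h p.1 * phi p.1 (gact h p.2))) => h _ p.
      apply: cvgM; first exact: cw.
      exact: phi_gact_continuous.
    apply: cvgV; first by rewrite gt_eqF// weight_sum_gt0.
    apply: (@continuous_sumr _ _ _ _ _
      (fun h (p : Z * X) => weight h p.1)) => h _; exact: cw.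
  rewrite /continuous_at [X in _ --> X]/phi_retract (negPf m0).
  apply: cvg_trans cmean; apply: near_eq_cvg; near=> p.
  by rewrite /phi_retract ifN//; near: p.
apply/cvgrPdist_le => /= e e0; rewrite phi_retract_eq0//.
(* The stabilizer of [phi z] under the action on functions. *)
pose St := [set h | `[< forall y, phi z (gact h y) = phi z y >]]%SET.
have gSt : group_set St.
  apply/group_setP; split.
    by rewrite inE; apply/asboolP => y; rewrite gact1.
  move=> a b; rewrite !inE => /asboolP ha /asboolP hb; apply/asboolP => y.
  by rewrite gactM ha hb.
have nphi : \forall p \near (z, x), forall h, h \in St ->
    `|phi z x - phi p.1 (gact h p.2)| <= e.
  apply: (@filter_forall _ _ _ _ (nbhs_filter (z, x))) => h.
  have [hSt|nhSt] := boolP (h \in St); last exact: nearW.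
  move: hSt; rewrite inE => /asboolP/(_ x) <-.
  have /cvgrPdist_le/(_ _ e0) := phi_gact_continuous h (z, x).
  by apply: filterS => p /= + _.
(* Since [delta_min z] is [0], this strict inequality holds at [z] and persists nearby. It excludes
   such [g] from every set of nonzero weight. *)
have ndelta : \forall p \near (z, x), forall g, delta g z != 0 ->
    2 * delta_min p.1 < delta g p.1.
  apply: (near_fst Z X _ _ (fun y => forall g, delta g z != 0 ->
    2 * delta_min y < delta g y)).
  apply: filter_forall => g.
  have [dg|dg] := eqVneq (delta g z) 0.
    by apply: nearW.
  have h : {for z, continuous (fun y => delta g y - 2 * delta_min y)}.
    apply: cvgB; first exact: delta_continuous.
    by apply: cvgM; [exact: cvg_cst|exact: delta_min_continuous].
  have : \forall y \near z, 0 < delta g y - 2 * delta_min y.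
    apply: (h (fun r => 0 < r)); apply: lt_nbhsr.
    by rewrite m0 mulr0 subr0 lt_neqAle eq_sym dg delta_ge0.
  by apply: filterS => y; rewrite subr_gt0.
near=> p.
have np h : h \in St -> `|phi z x - phi p.1 (gact h p.2)| <= e.
  by move: h; near: p.
have nd g : delta g z != 0 -> 2 * delta_min p.1 < delta g p.1.
  by move: g; near: p.
rewrite /phi_retract; case: eqP => [_|/eqP mp].
  by have := np _ (group1 (Group gSt)); rewrite gact1.
have mp_gt0 : 0 < delta_min p.1 by rewrite lt_neqAle eq_sym mp delta_ge0.
apply: mean_dist => [h||h]; first exact: weight_ge0.
  exact: weight_sum_gt0.
move=> wh; apply: np.
have [S hS cS] : exists2 S : {set gT}, h \in <<S^-1 * S>>%g &
    subset_weight S p.1 != 0.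
  apply: contrapT => nS; move/eqP: wh; apply; apply: big1 => S hS.
  by apply/eqP; apply: contrapT => /negP cS; apply: nS; exists S.
have [Sm _] := subset_weight_neq0 S p.1 cS.
have S0 g : g \in S -> delta g z = 0.
  move=> gS; apply/eqP; apply: contraT => dg.
  have := nd g dg.
  by rewrite ltNge (ltW (Sm _ gS)).
(* For [s] and [t] in [S], the function [psi z] is the translate of [phi z] by either of them, so
   [s^-1 * t] stabilizes [phi z]. *)
suff : (<<S^-1 * S>> \subset Group gSt)%g by move=> /fintype.subsetP/(_ h hS).
rewrite gen_subG; apply/fintype.subsetP => _ /mulsgP[a b + bS ->].
rewrite mem_invg => aS; rewrite inE; apply/asboolP => y.
have := (delta_eq0 a^-1%g z).1 (S0 _ aS) (gact b y).
have := (delta_eq0 b z).1 (S0 _ bS) (gact b y).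
by rewrite invgK -!gactM mulVg gact1 => -> .
Unshelve. all: by end_near. Qed.

(** Minimizers at nearby points are minimizers at [z], and by [phi_retract_nearest] each of these
    finitely many elements computes [psi_retract z]. *)
Lemma psi_retract_continuous : continuous (fun p => psi_retract p.1 p.2).
Proof.
move=> [z x]; apply/cvgrPdist_le => /= e e0.
have nphi : \forall p \near (z, x), forall g, delta g z = delta_min z ->
    `|psi_retract z x - phi_retract p.1 (gact g^-1%g p.2)| <= e.
  apply: (@filter_forall _ _ _ _ (nbhs_filter (z, x))) => g.
  have [dg|dg] := pselect (delta g z = delta_min z); last exact: nearW.
  rewrite /psi_retract (@phi_retract_nearest _ g)//.
  have : {for (z, x), continuous
      (fun p : Z * X => phi_retract p.1 (gact g^-1%g p.2))}.
    apply: (@continuous_comp _ _ _ (fun p : Z * X => (p.1, gact g^-1%g p.2))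
      (fun p => phi_retract p.1 p.2)); last exact: phi_retract_continuous.
    apply: cvg_pair; first exact: cvg_fst.
    apply: (@continuous_comp _ _ _ snd (gact g^-1%g)); first exact: cvg_snd.
    exact: gact_continuous_each.
  by move=> /cvgrPdist_le/(_ _ e0); apply: filterS => p /= + _.
have ndelta : \forall p \near (z, x), forall g, delta g z != delta_min z ->
    delta_min p.1 < delta g p.1.
  apply: (near_fst Z X _ _ (fun y => forall g, delta g z != delta_min z ->
    delta_min y < delta g y)).
  apply: filter_forall => g.
  have [dg|dg] := eqVneq (delta g z) (delta_min z).
    by apply: nearW.
  have h : {for z, continuous (fun y => delta g y - delta_min y)}.
    by apply: cvgB; [exact: delta_continuous|exact: delta_min_continuous].
  have : \forall y \near z, 0 < delta g y - delta_min y.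
    apply: (h (fun r => 0 < r)); apply: lt_nbhsr.
    by rewrite subr_gt0 lt_neqAle eq_sym dg delta_min_le.
  by apply: filterS => y; rewrite subr_gt0.
near=> p.
have np g : delta g z = delta_min z ->
    `|psi_retract z x - phi_retract p.1 (gact g^-1%g p.2)| <= e.
  by move: g; near: p.
have nd g : delta g z != delta_min z -> delta_min p.1 < delta g p.1.
  by move: g; near: p.
apply: np; apply/eqP; apply: contraT => /nd.
by rewrite ltxx.
Unshelve. all: by end_near. Qed.

End graph_retraction.

(** * Relative continuity and extension of the coordinates *)

Lemma within_continuous_comp (S T U : topologicalType) (A : set S) (B : set T)
    (f : S -> T) (g : T -> U) :
  continuous f -> (forall s, A s -> B (f s)) ->
  {within B, continuous g} -> {within A, continuous (g \o f)}.
Proof.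
move=> cf fAB /subspace_continuousP cg.
apply/subspace_continuousP => s As W /(cg _ (fAB _ As)) gW.
have : \forall t \near s, B (f t) -> W (g (f t)) by exact: cf gW.
by apply: filterS => t + At; apply; exact: fAB.
Qed.

(** Serves to corestrict maps: to [X] along the Kuratowski embedding, and to [daleth X] along the
    inclusion. *)
Lemma within_continuous_initial (S T U : topologicalType) (j : T -> U)
    (A : set S) (f : S -> T) (g : S -> U) :
  (forall B : set T, open B -> exists2 C : set U, open C & j @^-1` C = B) ->
  (forall s, A s -> j (f s) = g s) ->
  {within A, continuous g} -> {within A, continuous f}.
Proof.
move=> j_initial jf /subspace_continuousP cg.
apply/subspace_continuousP => s As W.
rewrite nbhsE => -[B [/j_initial[C oC <-] /= Cfs] BW].
have : nbhs (g s) C by rewrite -jf//; exact: open_nbhs_nbhs.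
move=> /(cg _ As) gC.
have : \forall t \near s, A t -> C (g t) by exact: gC.
apply: filterS => t Ct At; apply: BW => /=.
by rewrite jf//; exact: Ct.
Qed.

Lemma gembedding_continuous (gT : finGroupType) (X Z : gspace gT) (i : X -> Z) :
  closed_gembedding i -> continuous i.
Proof.
case=> _ _ i_initial _; apply/continuousP => B oB.
by apply/i_initial; exists B.
Qed.

(* [k] acts on [X] through [pr k]; for [c] the identity this extends the
   Kuratowski embedding [x |-> d x _], written in uncurried form. *)
Lemma extend_kuratowski (R : realType) (kT gT : finGroupType) (pr : kT -> gT)
    (Y Z : gspace kT) (X : gspace gT) (i : Y -> Z) (c : Y -> X)
    (d : X -> X -> R) :
  (forall k l, pr (k * l)%g = (pr k * pr l)%g) ->
  compact [set: X] -> metrizable R Z -> metrizes R X d ->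
  (forall g x y, d (gact g x) (gact g y) = d x y) ->
  closed_gembedding i ->
  continuous c -> (forall k y, c (gact k y) = gact (pr k) (c y)) ->
  exists f : Z -> X -> R, [/\ continuous (fun p => f p.1 p.2),
    forall k z x, f (gact k z) (gact (pr k) x) = f z x &
    forall y x, f (i y) x = d (c y) x].
Proof.
move=> prM cX mZ md dinv [iE injI i_initial cli] cc cE.
have nZX : normal_space (Z * X)%type.
  have [D mD] := @metrizable_prod R Z X mZ (ex_intro _ d md).
  exact: metrizes_normal mD.
pose A := [set p : Z * X | range i p.1].
(* The function to extend from [A]; its value [0] elsewhere is arbitrary. *)
pose f (p : Z * X) : R :=
  if pselect (exists y, i y = p.1) is left h then d (c (projT1 (cid h))) p.2
  else 0.
have fi y x : f (i y, x) = d (c y) x.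
  rewrite /f; case: pselect => [h|[]]; last by exists y.
  by case: cid => y' /= /injI ->.
have cA : closed A by apply: closed_comp => // p _; exact: cvg_fst.
(* Compactness of [X] provides the bound for Tietze's theorem. *)
have [M dM] : exists M, forall x y, d x y <= M.
  have : compact [set: X * X].
    by rewrite -setXTT; exact: compact_setX.
  move=> /(continuous_compact (continuous_subspaceT (metrizes_continuous md))).
  move=> /compact_bounded[M [_ dM]]; exists (M + 1) => x y.
  apply: le_trans (ler_norm _) _; apply: (dM (M + 1)); first by rewrite ltrDl.
  by exists (x, y).
(* With the group acting on both factors of [Z * X], equivariance of a map into functions on [X]
   becomes invariance of one real function. *)
have [||||||F [cF FA FE]] := @equivariant_tietze R kT (Z * X)%type
  (fun k p => (gact k p.1, gact (pr k) p.2)) A f M nZX cA.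
- move=> k p; apply: cvg_pair.
    apply: (@continuous_comp _ _ _ fst (gact k)); first exact: cvg_fst.
    exact: gact_continuous_each.
  apply: (@continuous_comp _ _ _ snd (gact (pr k))); first exact: cvg_snd.
  exact: gact_continuous_each.
- by move=> k l [z x] /=; rewrite prM !gactM.
- by move=> k [z x] [y _ <-] /=; exists (gact k y).
- apply/subspace_continuousP => -[z x] [y _ /= <-] W.
  change (nbhs (f (i y, x)) W ->
    \forall p \near (i y, x), A p -> W (f p)).
  rewrite fi => fW.
  have cdc : continuous (fun p : Y * X => d (c p.1) p.2).
    apply: (metrizes_continuous2 md (Y * X)%type (c \o fst) snd) => p.
      apply: (@continuous_comp _ _ _ fst c); first exact: cvg_fst.
      exact: cc.
    exact: cvg_snd.
  have [[P Q] /= [Py Qx] PQ] := cdc (y, x) _ fW.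
  (* An open set of [Y] is the trace of one of [Z], which turns continuity on [Y * X] into
     continuity relative to [A]. *)
  move: Py; rewrite nbhsE => -[B [/i_initial[C oC <-] /= Cy] BP].
  exists (C, Q); first by split => //=; apply: open_nbhs_nbhs.
  move=> [z' x'] /= [Cz' Qx'] [y' _ /= zE].
  rewrite -zE in Cz' *; rewrite fi.
  by apply: (PQ (y', x')); split => //; exact: BP.
- move=> [z x] [y _ /= <-]; rewrite fi ger0_norm; first exact: dM.
  by case: md.
- by move=> k [z x] [y _ /= <-]; rewrite -iE !fi cE dinv.
exists (fun z x => F (z, x)); split => [|k z x|y x].
- by rewrite (_ : (fun p => F (p.1, p.2)) = F)//; apply/funext => -[].
- exact: (FE k (z, x)).
- by rewrite FA ?fi//; exists y.
Qed.

(** * The neighbourhood retraction onto [daleth X] *)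

Lemma saturation_diagonalP (gT : finGroupType) (X : gspace gT) (p : X * X) :
  saturation (X := prod_gspace X X) diagonal p <-> exists g, p.2 = gact g p.1.
Proof.
split=> [[k _ [[x y] /= xy <-]]|[g pg]].
  (* The translate by [k] of a diagonal point lies on the graph of [k.2 * k.1^-1]. *)
  exists (k.2 * k.1^-1)%g; rewrite /diagonal /= in xy.
  by rewrite /= xy -gactM mulgKV.
exists (1%g, g) => //; exists (p.1, p.1) => //.
by rewrite /= /prod_gact /= gact1 -pg; case: p {pg}.
Qed.

Theorem theorem3p15 (R : realType) (gT : finGroupType) (X : gspace gT) :
  compact [set: X] -> GANR R X -> GANR R (daleth X).
Proof.
move=> cX [mX extX]; have [d md dinv] := metrizable_invariant R gT X mX.
have [_ dE _ _ _] := md.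
split.
  have [D mD] := metrizable_prod R X X mX mX.
  exact: metrizable_set_type mD _.
move=> Z i mZ iE.
(* A point [x0] provides default values below; if [X] is empty, so is the image of [i], and the
   empty neighbourhood works. *)
have [[x0]|X0] := pselect (inhabited X); last first.
  have Y0 (y : daleth X) : False by apply: X0; constructor; exact: (\val y).1.
  exists set0, id; split => //.
  - by split => // z [y _ _]; case: (Y0 y).
  - exact: continuous_subspaceT (fun z => cvg_id).
  - by move=> z [? []].
pose E := fun_gspace R X.
have mE : metrizable R E by exact: metrizable_uniform.
have [D mD Dinv] := metrizable_invariant R gT E mE.
pose kappa : X -> E := d.
have kappaE : closed_gembedding kappa.
  apply: closed_gembedding_compact => //.
  - exact: metrizes_hausdorff mD.
  - exact: continuous_curry_uniform cX (metrizes_continuous md).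
  - move=> x y xy; apply/dE.
    by rewrite -/(kappa x y) xy; exact: metrizes_refl md _.
  - move=> g x; apply/funext => y; rewrite /kappa /= /fun_gact.
    by rewrite -(dinv g^-1%g) -gactM mulVg gact1.
have [kE injk k_initial _] := kappaE.
have [V [rho0 [[nV iV] crho rhoV rho_id rho_E]]] := extX E kappa mE kappaE.
(* A left inverse of [kappa], made total by [x0]; with it [rho] is the retraction of [V] with values
   in [X] itself. *)
have /choice[kinv kinvE] : forall e : E, exists x, range kappa e -> kappa x = e.
  move=> e; have [[x _ xe]|ne] := pselect (range kappa e); first by exists x.
  by exists x0.
pose rho := kinv \o rho0.
have kappa_rho e : V e -> kappa (rho e) = rho0 e.
  by move=> Ve; apply: kinvE; apply: rhoV; exists e.
have rho_kappa x : rho (kappa x) = x.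
  by apply: injk; rewrite kinvE rho_id//; exists x.
have rho_gact g e : V e -> rho (gact g e) = gact g (rho e).
  move=> Ve; apply: injk; rewrite kE !kappa_rho//; first exact: rho_E.
  exact: iV.
have rho_cont : {within V, continuous rho}.
  by apply: within_continuous_initial kappa_rho crho => B /k_initial.
have val_cont : continuous (set_val : daleth X -> X * X).
  exact: initial_continuous.
have [|||phi [cphi phiE phi_i]] := @extend_kuratowski R _ _ fst (daleth X) Z X i
  (fun y => (\val y).1) d _ cX mZ md dinv iE.
- by [].
- move=> y; apply: (@continuous_comp _ _ _ (set_val : daleth X -> _) fst).
    exact: val_cont.
  exact: cvg_fst.
- by [].
have [|||psi [cpsi psiE psi_i]] := @extend_kuratowski R _ _ snd (daleth X) Z X i
  (fun y => (\val y).2) d _ cX mZ md dinv iE.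
- by [].
- move=> y; apply: (@continuous_comp _ _ _ (set_val : daleth X -> _) snd).
    exact: val_cont.
  exact: cvg_snd.
- by [].
pose delta g z := D (psi z : E) (gact g (phi z : E)).
have [D0 DE _ _ _] := mD.
have phi_gact k z : phi (gact k z) = gact k.1 (phi z : E) :> E.
  apply/funext => x; rewrite /= /fun_gact -(phiE k z) -gactM mulgV gact1//.
have psi_gact k z : psi (gact k z) = gact k.2 (psi z : E) :> E.
  apply/funext => x; rewrite /= /fun_gact -(psiE k z) -gactM mulgV gact1//.
have delta_cont g : continuous (delta g).
  apply: (metrizes_continuous2 mD).
    exact: continuous_curry_uniform cX cpsi.
  move=> z; apply: (@continuous_comp _ _ _ (phi : Z -> E) (gact g)).
    exact: (continuous_curry_uniform R Z X phi cX cphi).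
  exact: gact_continuous_each.
have delta0 g z : 0 <= delta g z by exact: D0.
have deltaE g z :
    delta g z = 0 <-> forall x, psi z x = phi z (gact g^-1%g x).
  split=> [/DE -> //|pg]; apply/DE; exact/funext.
have delta_gact k g z :
    delta (k.2 * g * k.1^-1)%g (gact k z) = delta g z.
  by rewrite /delta phi_gact psi_gact -gactM mulgKV gactM Dinv.
pose phi' := phi_retract phi delta; pose psi' := psi_retract phi delta.
have cphi' : continuous (phi' : Z -> E).
  apply: continuous_curry_uniform => //.
  exact: (@phi_retract_continuous _ _ _ _ phi psi).
have cpsi' : continuous (psi' : Z -> E).
  apply: continuous_curry_uniform => //.
  exact: (@psi_retract_continuous _ _ _ _ phi psi).
have phi'E k z : phi' (gact k z) = gact k.1 (phi' z : E) :> E.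
  apply/funext => x; rewrite /= /fun_gact.
  rewrite /phi' -(phi_retract_equivariant phi delta phiE delta_gact k z).
  by rewrite -gactM mulgV gact1.
have psi'E k z : psi' (gact k z) = gact k.2 (psi' z : E) :> E.
  apply/funext => x; rewrite /= /fun_gact.
  rewrite /psi'.
  rewrite -(psi_retract_equivariant phi psi delta phiE deltaE delta_gact k z).
  by rewrite -gactM mulgV gact1.
(* By conversion: [psi_retract] precomposes [phi_retract] with the inverse of [nearest], which is
   the action on [E]. *)
have psi'_phi' z : exists g, psi' z = gact g (phi' z : E) :> E.
  by exists (nearest delta z).
(* At a point [(x, g x)] invariance of [d] gives psi = g phi, so the construction leaves both
   coordinates unchanged there. *)
have delta_i y : delta_min delta (i y) = 0.
  have /saturation_diagonalP[g yg] := set_valP y.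
  apply: (delta_min_eq0 delta delta0 g); apply/deltaE => x.
  by rewrite psi_i phi_i -(dinv g (\val y).1) -yg -gactM mulgV gact1.
have phi'_i y : phi' (i y) = kappa (\val y).1.
  by rewrite /phi' phi_retract_eq0//; apply/funext => x; rewrite phi_i.
have psi'_i y : psi' (i y) = kappa (\val y).2.
  rewrite /psi' (@psi_retract_eq0 _ _ _ _ _ psi)//.
  by apply/funext => x; rewrite psi_i.
(* Constraining [phi'] suffices, since [psi' z] is a translate of [phi' z] and [V] is invariant. *)
pose U : set Z := [set z | V (phi' z)].
have Vpsi' z : U z -> V (psi' z).
  by move=> Uz; have [g ->] := psi'_phi' z; exact: iV.
pose s z := (rho (phi' z), rho (psi' z)).
have s_daleth z : U z -> saturation (X := prod_gspace X X) diagonal (s z).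
  move=> Uz; apply/saturation_diagonalP; have [g pg] := psi'_phi' z.
  by exists g; rewrite /s /= pg rho_gact.
have y0P : saturation (X := prod_gspace X X) diagonal (x0, x0).
  by apply/saturation_diagonalP; exists 1%g; rewrite gact1.
(* The default value of [insubd] can occur only for [s z] with [z] outside [U]. *)
pose mk : X * X -> daleth X := insubd (SigSub (mem_set y0P) : daleth X).
have val_mk z : U z -> \val (mk (s z)) = s z.
  by move=> Uz; apply: insubdK; apply: mem_set; exact: s_daleth.
have s_i y : s (i y) = \val y.
  by rewrite /s phi'_i psi'_i !rho_kappa; case: (\val y).
have s_gact k z : U z -> s (gact k z) = gact k (s z : prod_gspace X X).
  by move=> Uz; rewrite /s phi'E psi'E !rho_gact//; exact: Vpsi'.
have iU : ginvariant U.
  by move=> k z Uz; rewrite /U /= phi'E; exact: iV.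
have Ui y : nbhs (i y) U.
  by apply: cphi'; rewrite phi'_i; apply: nV; exists (\val y).1.
exists U, (fun z => i (mk (s z))); split.
- by split => // _ [y _ <-]; exact: Ui.
- have cs : {within U, continuous s}.
    move=> z; apply: cvg_pair.
      exact: (@within_continuous_comp _ _ _ U V phi' rho cphi' _ rho_cont).
    exact: (@within_continuous_comp _ _ _ U V psi' rho cpsi' Vpsi' rho_cont).
  have cmk : {within U, continuous (mk \o s)}.
    by apply: within_continuous_initial val_mk cs => B [C oC <-]; exists C.
  move=> z; apply: (@continuous_comp _ _ _ (mk \o s : subspace U -> _) i).
    exact: cmk.
  exact: gembedding_continuous iE _.
- by move=> _ [z _ <-]; exists (mk (s z)).
- move=> _ [y _ <-]; congr i; apply: val_inj.
  by rewrite val_mk ?s_i//; exact: nbhs_singleton (Ui y).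
- move=> k z Uz; have [iG _ _ _] := iE; rewrite -iG; congr i; apply: val_inj.
  by rewrite val_mk ?s_gact//=; [rewrite val_mk|exact: iU].
Qed.
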